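(* Let $m\ge 1$ be an integer, $N=127^m$, $f=\phi(127^m)/18$ and $q=2^f$ (here $\mathrm{ord}_{127^m}(2)=\phi(127^m)/18$, so $N\mid q-1$). Let $\gamma$ be a fixed primitive element of $\mathbb{F}_q$, let $C_i=\{\gamma^{i+jN}\mid 0\le j\le\frac{q-1}{N}-1\}$ for $0\le i\le N-1$, and let $D=\bigcup_{i=0}^{127^{m-1}-1}C_i$. Then $\mathrm{Cay}(\mathbb{F}_q,D)$ is a strongly regular graph.
   Context: $\phi$ is the Euler totient function and $\mathrm{ord}_n(a)$ is the multiplicative order of $a$ modulo $n$. For $D\subseteq\mathbb{F}_q^*$ with $-D=D$, $\mathrm{Cay}(\mathbb{F}_q,D)$ is the graph with vertex set $\mathbb{F}_q$ in which two vertices are adjacent if and only if their difference belongs to $D$. A strongly regular graph srg$(v,k,\lambda,\mu)$ is a simple undirected regular graph of order $v$ and valency $k$, neither complete nor edgeless, such that any two adjacent vertices have exactly $\lambda$ common neighbors and any two (distinct) nonadjacent vertices have exactly $\mu$ common neighbors; connectedness is not required. *)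

(* Defs.v *)
From HB Require Import structures.
From mathcomp Require Import all_boot all_order all_algebra.

Set Implicit Arguments.
Unset Strict Implicit.
Unset Printing Implicit Defensive.

Import GRing.Theory.
Local Open Scope ring_scope.

Definition simple_graph (T : finType) (e : rel T) : Prop :=
  symmetric e /\ irreflexive e.

Definition common_neighbors (T : finType) (e : rel T) (x y : T) : {set T} :=
  [set z | e x z && e y z].

Definition srg (T : finType) (e : rel T) (v k lam mu : nat) : Prop :=
  [/\ [/\ simple_graph e, #|T| = v & forall x, #|[set y | e x y]| = k],
      exists x y, x != y /\ ~~ e x y,
      exists x y, e x y,
      forall x y, e x y -> #|common_neighbors e x y| = lam
    & forall x y, x != y -> ~~ e x y -> #|common_neighbors e x y| = mu].

Definition strongly_regular (T : finType) (e : rel T) : Prop :=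
  exists v k lam mu, srg e v k lam mu.

(* A bare relation: that it is symmetric and irreflexive, i.e. -D = D and
   0 \notin D, is part of [strongly_regular (Cay D)]. *)
Definition Cay (V : finZmodType) (D : {set V}) : rel V :=
  fun x y => x - y \in D.

(* C_i; the truncated division is the exact (q - 1)/N as soon as N %| q - 1. *)
Definition cyclotomic_class (F : finFieldType) (gamma : F) (N i : nat) :
    {set F} :=
  [set gamma ^+ (i + j * N) | j : 'I_(#|F|.-1 %/ N)].

Definition is_mult_order (n a d : nat) : Prop :=
  [/\ (0 < d)%N, a ^ d = 1 %[mod n]
    & forall e, (0 < e)%N -> a ^ e = 1 %[mod n] -> (d <= e)%N].

(* Main.v *)
Require Import Defs.
From mathcomp Require Import all_boot all_order all_algebra.
From mathcomp Require Import all_field zify ring.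

(** Put p = 127 = 2^r - 1 with r = 7, l = p^(m-1), N = p l, f = r l, q = 2^f,
    and let Psi a be the sum over y in D of psi (a y), where psi is the
    canonical additive character of F. In the expansion of the indicator of D
    over the characters of order dividing N, only those of exact order N
    contribute apart from the trivial one, so l (p Psi a + 1) is a combination
    of Gauss sums of exact order N. By (half of) Stickelberger's theorem, proved
    with Jacobi sums, each of these is divisible by 2^(h+1) at the prime above
    2, where h = r (l - 1) / 2: the binary weight of j (q - 1) / N is read off
    the residues of 2^k j mod N, which for p not dividing j fill whole classes
    mod p. With M = 2^h, which is 1 mod p, it follows that
    p Psi a + 1 = M (p X + 1) for an odd integer X.
    Parseval says that the mean of X^2 over the nonzero a is 1, and X^2 >= 1
    for odd X, so X is 1 or -1: the Cayley graph of D has two eigenvalues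
    besides its valency. *)

Set Implicit Arguments.
Unset Strict Implicit.
Unset Printing Implicit Defensive.

Import Order.TTheory GRing.Theory Num.Theory.
Local Open Scope ring_scope.

(** Division by the monic 'Phi_n leaves a remainder of smaller degree than the minimal polynomial of
    [z], hence zero; and 'Phi_n kills [g], since a root of 'Phi_d has order dividing d. This makes
    the reduction map [z] to [g] well defined. *)
Lemma horner_int_primitive_root (R : fieldType) (n : nat) (z : algC) (g : R)
    (P : {poly int}) :
  n.-primitive_root z -> n.-primitive_root g ->
  (map_poly intr P).[z] = 0 -> (map_poly intr P).[g] = 0.
Proof.
move=> pz pg Pz; have n_gt0 := prim_order_gt0 pz.
have Phig: (map_poly intr ('Phi_n)).[g] = 0.
  have: root (map_poly intr (\prod_(d <- divisors n) 'Phi_d)) g.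
    rewrite prod_Cyclotomic // rmorphB rmorph1 /= map_polyXn rootE !hornerE.
    by rewrite (prim_expr_order pg) subrr.
  rewrite rmorph_prod /= rootE horner_prod prodf_seq_eq0 => /hasP[d].
  rewrite -dvdn_divisors // => dn rd; suff: (n %| d)%N.
    by move=> nd; apply/eqP; have /eqP <- : d == n by rewrite eqn_dvd dn.
  have d_gt0 := dvdn_gt0 n_gt0 dn.
  rewrite (prim_order_dvd pg) -subr_eq0.
  have: root (map_poly intr (\prod_(d0 <- divisors d) 'Phi_d0)) g.
    rewrite (big_rem d) -?dvdn_divisors //= rmorphM /= rootM.
    by rewrite [root _ _]rd.
  by rewrite prod_Cyclotomic // rmorphB rmorph1 /= map_polyXn rootE !hornerE.
have := Pdiv.RingMonic.rdivp_eq (Cyclotomic_monic n) P.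
set Q := Pdiv.Ring.rdivp _ _; set S := Pdiv.Ring.rmodp _ _ => PE.
suff S0: S = 0 by rewrite PE S0 addr0 rmorphM /= hornerM Phig mulr0.
have szS: (size S < size 'Phi_n)%N.
  by rewrite Pdiv.Ring.ltn_rmodp monic_neq0 ?Cyclotomic_monic.
have Phiz: (map_poly intr 'Phi_n).[z] = 0.
  by apply/eqP; rewrite -rootE (Cintr_Cyclotomic pz) root_cyclotomic.
have Sz: root (map_poly intr S) z.
  by move: Pz; rewrite PE rmorphD rmorphM /= hornerD hornerM Phiz mulr0 add0r rootE => ->.
have [pf [Dpf mpf] dv] := minCpolyP z.
apply/eqP; apply/negPn/negP => nzS.
have SQ : map_poly intr S = map_poly ratr (map_poly (intr : int -> rat) S) :> {poly algC}.
  by rewrite -map_poly_comp; apply: eq_map_poly => a /=; rewrite rmorph_int.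
rewrite SQ dv in Sz.
have nzS' : map_poly (intr : int -> rat) S != 0.
  by rewrite -size_poly_eq0 size_map_inj_poly ?size_poly_eq0 //; apply: intr_inj.
have := dvdp_leq nzS' Sz; rewrite size_map_inj_poly //; last exact: intr_inj.
rewrite leqNgt -(@size_map_poly _ algC ratr) -Dpf (minCpoly_cyclotomic pz).
by rewrite -(Cintr_Cyclotomic pz) size_map_inj_poly ?szS //; apply: intr_inj.
Qed.

(** * Powers of 2 modulo powers of a Mersenne prime *)

Section MersennePowers.
Variables (p r : nat).
Hypotheses (pr_p : prime p) (p2r : p.+1 = (2 ^ r)%N).

Let p_gt0 : (0 < p)%N. Proof. exact: prime_gt0. Qed.

Lemma mersenne_exp_gt1 : (1 < r)%N.
Proof.
by move: p2r (prime_gt1 pr_p); case: r => [|[|]] // [->].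
Qed.

Lemma mersenne_odd : odd p.
Proof.
have := mersenne_exp_gt1; have : odd p.+1 = odd (2 ^ r) by rewrite p2r.
by rewrite oddX /=; case: (odd p) => //=; case: r.
Qed.

Lemma exp_succ_mod_sq e : exists k, (p.+1 ^ e = 1 + p * (e + p * k))%N.
Proof.
elim: e => [|e [k ke]]; first by exists 0%N; rewrite expn0 !muln0.
by exists (k + (e + p * k))%N; rewrite expnS ke; ring.
Qed.

Lemma geometric_sum_mod_sq a k :
  exists s, (\sum_(i < k) (1 + p * a) ^ i = k + p * (a * 'C(k, 2)) + p ^ 2 * s)%N.
Proof.
have E i : exists t, ((1 + p * a) ^ i = 1 + p * (i * a) + p ^ 2 * t)%N.
  elim: i => [|i [t IH]]; first by exists 0%N; rewrite expn0 mul0n !muln0.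
  exists (t + i * a * a + p * t * a)%N; rewrite expnS IH; ring.
elim: k => [|k [s IH]]; first by exists 0%N; rewrite big_ord0 !muln0.
have [t Et] := E k; exists (s + t)%N.
by rewrite big_ord_recr /= IH Et binS bin1; ring.
Qed.

(* The valuation formula v_p((p + 1)^e - 1) = 1 + v_p(e). *)
Lemma dvdn_exp_succ_pred (m e : nat) :
  (p ^ m.+1 %| (p.+1 ^ e).-1)%N = (p ^ m %| e)%N.
Proof.
elim: m e => [|m IH] e.
  by have [k ->] := exp_succ_mod_sq e; rewrite expn1 dvdn_mulr // dvd1n.
have [pe|npe] := boolP (p %| e)%N; last first.
  have -> : (p ^ m.+1 %| e)%N = false.
    apply/negP => H; case/negP: npe; apply: dvdn_trans H.
    by rewrite expnS dvdn_mulr.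
  apply/negP => H; case/negP: npe.
  have : (p ^ 2 %| (p.+1 ^ e).-1)%N.
    by apply: dvdn_trans H; apply: dvdn_exp2l.
  have [k ->] := exp_succ_mod_sq e; rewrite add1n /= expnS expn1.
  by rewrite dvdn_pmul2l // dvdn_addl ?dvdn_mulr.
case/dvdnP: pe => e' ->; rewrite expnM predn_exp.
rewrite [in RHS]expnSr dvdn_pmul2r // -IH.
have [k Ek] := exp_succ_mod_sq e'.
(* For odd [p] the binomial 'C(p, 2) is a multiple of [p], so the geometric sum is [p] times a
   number that is 1 mod [p]: its valuation is exactly 1. *)
have [s ->] : exists s, (\sum_(i < p) (p.+1 ^ e') ^ i = p * (1 + p * s))%N.
  rewrite Ek; have [s ->] := geometric_sum_mod_sq (e' + p * k) p.
  have [c ->] : exists c, ('C(p, 2) = p * c)%N.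
    by exists (p.-1 %/ 2)%N; rewrite bin2odd ?mersenne_odd // -divn2.
  by exists ((e' + p * k) * c + s)%N; ring.
rewrite -/(expn p m.+2) (expnS p m.+1) mulnCA dvdn_pmul2l //.
rewrite Gauss_dvdl // coprimeXl // /coprime.
by rewrite addnC mulnC gcdnMDl gcdn1.
Qed.

(** Since 2^r = 1 mod [p], the exponent may be reduced mod [r]; the remaining power of 2 is smaller
    than [p], so it is 1 mod [p] only if its exponent is 0. *)
Lemma dvdn_pred_exp2_mersenne e : (p %| (2 ^ e).-1)%N = (r %| e)%N.
Proof.
have r_gt1 := mersenne_exp_gt1.
have E : (2 ^ e = 2 ^ (e %% r) %[mod p])%N.
  rewrite {1}(divn_eq e r) expnD (mulnC _ r) expnM -p2r -modnMml.
  by rewrite -modnXm -(addn1 p) modnDl (modn_small (prime_gt1 pr_p)) exp1n modnMml mul1n.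
rewrite -subn1 -eqn_mod_dvd ?expn_gt0 // E /dvdn.
have lt_er : (e %% r < r)%N by rewrite ltn_mod ltnW.
have lt_p : (2 ^ (e %% r) < p)%N.
  have : (2 * 2 ^ (e %% r) <= p.+1)%N by rewrite p2r -expnS leq_pexp2l.
  by have := mersenne_odd; have := prime_gt1 pr_p; case: (p) => [|[|[|p']]] //; lia.
rewrite (modn_small lt_p) (modn_small (prime_gt1 pr_p)) -{2}(expn0 2).
by rewrite eqn_exp2l.
Qed.

Lemma dvdn_pred_exp2 m e : (p ^ m.+1 %| (2 ^ e).-1)%N = (r * p ^ m %| e)%N.
Proof.
have r_gt0 : (0 < r)%N by apply: ltnW mersenne_exp_gt1.
have [/dvdnP[e' ->]|nre] := boolP (r %| e)%N.
  by rewrite mulnC expnM -p2r dvdn_exp_succ_pred dvdn_pmul2l.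
rewrite [RHS]negbTE; last by apply: contra nre; apply: dvdn_trans (dvdn_mulr _ _).
apply: negbTE; apply: contra nre; rewrite -dvdn_pred_exp2_mersenne.
by apply: dvdn_trans; rewrite expnS dvdn_mulr.
Qed.

(** By the valuation formula the powers of p + 1 run once through the residues mod p^(m+1) that are
    1 mod [p]. Multiplied by [c] they fill the class of [c] mod [p], so the sum is that of an
    arithmetic progression. *)
Lemma sum_geometric_residues m c : ~~ (p %| c)%N ->
  (\sum_(t < p ^ m) ((c * p.+1 ^ t) %% p ^ m.+1)
     = p ^ m * (c %% p) + p * 'C(p ^ m, 2))%N.
Proof.
move=> npc; set l := (p ^ m)%N.
have l_gt0 : (0 < l)%N by rewrite expn_gt0 p_gt0.
have N_gt0 : (0 < p ^ m.+1)%N by rewrite expn_gt0 p_gt0.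
have val_mod (t : nat) : (((c * p.+1 ^ t) %% p ^ m.+1) %% p = c %% p)%N.
  rewrite modn_dvdm ?expnS ?dvdn_mulr // -modnMmr -modnXm -addn1 modnDl.
  by rewrite (modn_small (prime_gt1 pr_p)) exp1n modnMmr muln1.
pose s (t : 'I_l) := ((c * p.+1 ^ t) %% p ^ m.+1 %/ p)%N.
have s_lt t : (s t < l)%N by rewrite ltn_divLR // (leq_trans (ltn_pmod _ N_gt0)) // expnSr.
pose h t := Ordinal (s_lt t).
have inj_h : injective h.
  suff H (t t' : 'I_l) : h t = h t' -> (t <= t')%N -> t = t'.
    move=> t t' E; have [/H->|/ltnW/H] // := leqP t t'.
    by move=> /(_ (esym E)).
  move=> /(congr1 val) /= E le_tt'; apply/val_inj => /=.
  have : (c * p.+1 ^ t == c * p.+1 ^ t' %[mod p ^ m.+1])%N.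
    rewrite (divn_eq (_ %% _) p) val_mod -/(s t) E.
    by rewrite [eqbRHS](divn_eq _ p) val_mod.
  rewrite eq_sym eqn_mod_dvd ?leq_mul2l ?leq_pexp2l ?orbT // -mulnBr Gauss_dvdr; last first.
    by rewrite coprimeXl // prime_coprime.
  rewrite -{1}(subnK le_tt') expnD -{2}[(p.+1 ^ t)%N]mul1n -mulnBl.
  rewrite Gauss_dvdl ?subn1 ?dvdn_exp_succ_pred; last first.
    by rewrite coprimeXl ?coprimeXr // coprimenS.
  move=> /dvdn_leq; have := ltn_ord t'; rewrite -/l; lia.
transitivity (\sum_(t < l) (c %% p + p * h t))%N.
  by apply: eq_bigr => t _; rewrite [LHS](divn_eq _ p) val_mod addnC mulnC.
rewrite big_split /= sum_nat_const card_ord -big_distrr /=; congr (_ + p * _)%N.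
rewrite -bin2_sum big_mkord [RHS](reindex_inj inj_h) /=; exact: eq_bigr.
Qed.

(** The summands are the binary digits of j / N with N = p^(m+1), over the period r p^m. Their sum W
    satisfies W N = sum of the residues 2^k j mod N, and these fill [r] classes mod [p], each with
    least residue at most p - 1. *)
Lemma binary_weight_le m j : ~~ (p %| j)%N -> (j < p ^ m.+1)%N ->
  (\sum_(k < r * p ^ m) (2 ^ k.+1 * j %/ p ^ m.+1 - 2 * (2 ^ k * j %/ p ^ m.+1))
     <= r.-1 + r * (p ^ m)./2)%N.
Proof.
move=> npj; set l := (p ^ m)%N; set N := (p ^ m.+1)%N => ltj.
pose A k := (2 ^ k * j %/ N)%N.
have r_gt0 : (0 < r)%N by apply: ltnW mersenne_exp_gt1.
have N_gt0 : (0 < N)%N by rewrite expn_gt0 p_gt0.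
have odd_l : odd l by rewrite oddX mersenne_odd orbT.
pose R k := (2 ^ k * j %% N)%N.
pose d k := (A k.+1 - 2 * A k)%N.
have step k : (2 * R k = R k.+1 + d k * N)%N.
  have E : (2 * (A k * N + R k) = A k.+1 * N + R k.+1)%N.
    by rewrite -!divn_eq expnS mulnA.
  have := ltn_pmod (2 ^ k.+1 * j) N_gt0; rewrite -/(R _).
  have := ltn_pmod (2 ^ k * j) N_gt0; rewrite -/(R _) => ? ?.
  have le_A : (2 * A k <= A k.+1)%N.
    by rewrite -ltnS -(ltn_pmul2r N_gt0) mulSn; lia.
  have : (2 * A k * N <= A k.+1 * N)%N by rewrite leq_mul2r le_A orbT.
  by rewrite /d mulnBl; lia.
rewrite -[leqLHS]/(\sum_(k < r * l) d k)%N; set W := (\sum_(k < _) _)%N.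
have RW : (\sum_(k < r * l) R k = W * N)%N.
  have tele n : (\sum_(k < n) R k + R 0 = R n + (\sum_(k < n) d k) * N)%N.
    move: (R) (d) step => R' d' step'.
    elim: n => [|n IH]; first by rewrite !big_ord0 mul0n addn0.
    rewrite !big_ord_recr /= mulnDl addnAC IH addnAC addnn -mul2n step'.
    by rewrite -addnA [(d' n * _ + _)%N]addnC.
  have Rf : R (r * l)%N = R 0%N.
    apply/eqP; rewrite /R expn0 -modnMml.
    have : (2 ^ (r * l) == 1 %[mod N])%N.
      by rewrite eqn_mod_dvd ?expn_gt0 // subn1 dvdn_pred_exp2.
    by move/eqP->; rewrite modnMml.
  by have := tele (r * l)%N; rewrite Rf -/W; lia.
have sumR : (\sum_(k < r * l) R k = \sum_(i < r) (l * ((2 ^ i * j) %% p) + p * 'C(l, 2)))%N.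
  (* Writing k = i + r t gives 2^k = 2^i (p + 1)^t, so each inner sum runs over one full class mod
     [p]. *)
  have sum_by_residue n : (\sum_(k < r * n) R k = \sum_(i < r) \sum_(t < n) R (i + r * t))%N.
    elim: n => [|n IH]; first by rewrite muln0 big_ord0 big1 // => i _; rewrite big_ord0.
    rewrite mulnSr big_split_ord /= IH -big_split; apply: eq_bigr => i _ /=.
    by rewrite big_ord_recr /= [(i + r * n)%N]addnC.
  rewrite sum_by_residue; apply: eq_bigr => i _; rewrite -sum_geometric_residues.
    by apply: eq_bigr => t _; rewrite /R expnD expnM -p2r mulnAC.
  rewrite Euclid_dvdM // Euclid_dvdX // negb_or npj andbT negb_and.
  by apply/orP; left; rewrite dvdn_prime2 //; move: mersenne_odd; case: eqP => // ->.
have : (\sum_(i < r) (l * ((2 ^ i * j) %% p) + p * 'C(l, 2))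
          <= \sum_(i < r) (l * p.-1 + p * 'C(l, 2)))%N.
  apply: leq_sum => i _; rewrite leq_add2r leq_mul2l; apply/orP; right.
  by rewrite -ltnS prednK // ltn_mod.
rewrite -sumR RW sum_nat_const card_ord bin2odd // /N expnS -/l.
have l_gt0 : (0 < l)%N by rewrite expn_gt0 p_gt0.
have -> : (r * (l * p.-1 + p * (l * l.-1./2)) = (r * (p.-1 + p * l./2)) * l)%N.
  have -> : l.-1./2 = l./2 by case: (l) odd_l => //= n /negbTE; rewrite uphalf_half => ->.
  by ring.
rewrite mulnA leq_pmul2r // => H.
(* Replacing p - 1 by [p] makes the bound strict. The unit gained here is the extra factor 2 that
   later forces the eigenvalue factor X to be odd. *)
have : (W * p < (r + r * l./2) * p)%N.
  by apply: leq_ltn_trans H _; have := ltn_predL p; nia.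
by rewrite ltn_pmul2r // => ?; rewrite -ltnS -addSn prednK.
Qed.
End MersennePowers.

(** * Gauss sums over fields of characteristic 2 *)

Lemma sum_primitive_root_exp (R : fieldType) n (z : R) a :
  n.-primitive_root z ->
  \sum_(k < n) (z ^+ a) ^+ k = if (n %| a)%N then n%:R else 0.
Proof.
move=> pz; case: ifP => [/dvdnP[b ->]|na].
  under eq_bigr do rewrite mulnC exprM (prim_expr_order pz) !expr1n.
  by rewrite sumr_const card_ord.
apply/eqP; have : (z ^+ a - 1) * (\sum_(k < n) (z ^+ a) ^+ k) == 0.
  by rewrite -subrX1 -exprM mulnC exprM (prim_expr_order pz) expr1n subrr.
by rewrite mulf_eq0 subr_eq0 -(prim_order_dvd pz) na.
Qed.

Section AdditiveCharacter.
Variables (F : finFieldType) (f : nat).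
Hypothesis cardF : #|F| = (2 ^ f)%N.

Definition trace2 (x : F) := \sum_(i < f) x ^+ (2 ^ i).

Definition psi (x : F) : int := if trace2 x == 0 then 1 else -1.

Lemma pchar2 : 2%N \in [pchar F].
Proof. exact: card_finPcharP cardF _. Qed.

Lemma trace2D x y : trace2 (x + y) = trace2 x + trace2 y.
Proof.
rewrite -big_split; apply: eq_bigr => i _ /=; rewrite exprDn_pchar //.
by rewrite (eq_pnat _ (pcharf_eq pchar2)) pnatX pnat_id ?orbT.
Qed.

Lemma trace2_sqr x : trace2 (x ^+ 2) = trace2 x.
Proof.
rewrite /trace2; case: f cardF => [|f'] cF; first by rewrite !big_ord0.
rewrite big_ord_recr big_ord_recl /= addrC -exprM -expnS -cF expf_card expr1.
by congr (_ + _); apply: eq_bigr => i _; rewrite -exprM -expnS.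
Qed.

Lemma sqr_trace2 x : trace2 x ^+ 2 = trace2 x.
Proof.
rewrite -[RHS]trace2_sqr /trace2 -(pFrobenius_autE pchar2) rmorph_sum /=.
by apply: eq_bigr => i _; rewrite pFrobenius_autE -!exprM mulnC.
Qed.

Lemma trace2E x : trace2 x = (trace2 x != 0)%:R.
Proof.
have /eqP := sqr_trace2 x; rewrite expr2 -subr_eq0 -{3}[trace2 x]mulr1 -mulrBr.
by rewrite mulf_eq0 subr_eq0; case: eqP => [->//|_ /eqP->].
Qed.

Lemma psi0 : psi 0 = 1.
Proof. by rewrite /psi /trace2 big1 ?eqxx // => i _; rewrite expr0n expn_eq0. Qed.

Lemma psiD x y : psi (x + y) = psi x * psi y.
Proof.
rewrite /psi trace2D (trace2E x) (trace2E y).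
case: (trace2 x == 0); case: (trace2 y == 0) => /=; rewrite ?addr0 ?add0r ?eqxx ?oner_eq0 //.
by rewrite (addrr_pchar2 pchar2) eqxx.
Qed.

Lemma psi_sqr x : psi (x ^+ 2) = psi x.
Proof. by rewrite /psi trace2_sqr. Qed.

(** * Discrete logarithms and sums over the powers of a primitive root *)

Variable g : F.
Hypothesis pg : (2 ^ f).-1.-primitive_root g.
Hypothesis f_gt1 : (1 < f)%N.
Local Notation n := (2 ^ f).-1.

Lemma pred_exp2K : n.+1 = (2 ^ f)%N. Proof. by rewrite prednK ?expn_gt0. Qed.

Lemma pred_exp2_gt1 : (1 < n)%N.
Proof. by rewrite -ltnS pred_exp2K -(expn1 2) ltn_exp2l. Qed.

Let n_gt0 : (0 < n)%N := ltnW pred_exp2_gt1.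

Lemma primitive_root_neq0 : g != 0.
Proof.
apply: contra_eq_neq (prim_expr_order pg) => ->.
by rewrite expr0n gtn_eqF // eq_sym oner_neq0.
Qed.

Lemma primitive_root_expP x : x != 0 -> exists k : 'I_n, x = g ^+ k.
Proof.
move=> nz; have : x ^+ n = 1.
  by apply: (mulfI nz); rewrite -exprS pred_exp2K -cardF expf_card mulr1.
by move/(prim_rootP pg) => [k ->]; exists k.
Qed.

Lemma natr_pred_exp2 : n%:R = 1 :> F.
Proof.
have : n.+1%:R = 0 :> F.
  rewrite pred_exp2K; apply/eqP; rewrite -(dvdn_pcharf pchar2).
  by rewrite -(expn1 2) dvdn_exp2l // ltnW.
by rewrite -addn1 natrD => /eqP; rewrite addr_eq0 (oppr_pchar2 pchar2) => /eqP.
Qed.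

(** The default 0 is taken only at x = 0, so [omega] is 1 there and character sums must exclude 0
    explicitly. *)
Definition dlog (x : F) : 'I_n := odflt (Ordinal n_gt0) [pick k : 'I_n | x == g ^+ k].

Lemma dlogK x : x != 0 -> g ^+ dlog x = x.
Proof.
move=> /primitive_root_expP[k Dx]; rewrite /dlog; case: pickP => [k' /eqP -> //|/(_ k)].
by rewrite Dx eqxx.
Qed.

Lemma dlogX k : dlog (g ^+ k) = (k %% n)%N :> nat.
Proof.
have /eqP := dlogK (expf_neq0 k primitive_root_neq0).
by rewrite (eq_prim_root_expr pg) modn_small // => /eqP.
Qed.

Lemma sum_primitive_powers (V : nmodType) (H : F -> V) :
  \sum_(x | x != 0) H x = \sum_(k < n) H (g ^+ k).
Proof.
rewrite (reindex_onto (fun k : 'I_n => g ^+ k) dlog) => [|x]; last exact: dlogK.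
apply: eq_bigl => k; rewrite expf_neq0 ?primitive_root_neq0 //=.
by apply/eqP/val_inj; rewrite /= dlogX modn_small.
Qed.

Lemma sum_nonzero_expr a : \sum_(x : F | x != 0) x ^+ a = (n %| a)%N%:R.
Proof.
rewrite sum_primitive_powers; under eq_bigr do rewrite exprAC.
by rewrite (sum_primitive_root_exp _ pg) natr_pred_exp2; case: ifP.
Qed.

(** In the expanded trace only the term i = 0 has an exponent divisible by [n]. The identity yields
    both the nontriviality of [psi] and the reduction of the Gauss sum at [n.-1]. *)
Lemma sum_trace2_inv : \sum_(x | x != 0) trace2 x * x ^+ n.-1 = 1.
Proof.
under eq_bigr do rewrite mulr_suml.
rewrite exchange_big /= (bigD1 (Ordinal (ltnW f_gt1))) //= [X in _ + X]big1 => [|i nz_i].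
   under eq_bigr do rewrite expr1 -exprS prednK //.
  by rewrite sum_nonzero_expr dvdnn addr0.
under eq_bigr do rewrite -exprD.
rewrite sum_nonzero_expr -[(2 ^ i)%N]prednK ?expn_gt0 // addSnnS prednK //.
rewrite dvdn_addl // gtnNdvd //.
  by rewrite -ltnS prednK ?expn_gt0 // -(expn0 2) ltn_exp2l // lt0n.
by rewrite -ltnS pred_exp2K prednK ?expn_gt0 // ltn_exp2l.
Qed.

Lemma sum_psi : \sum_x psi x = 0.
Proof.
have [x tx] : exists x, psi x = -1.
  case: (pickP (fun x => psi x == -1)) => [x /eqP|all1]; first by exists x.
  have /eqP := sum_trace2_inv; rewrite big1 ?(eq_sym 0) ?oner_eq0 // => x _.
  have := all1 x; rewrite /psi; case: (trace2 x =P 0) => [->|//]; by rewrite mul0r.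
have : \sum_y psi y = - \sum_y psi y.
  rewrite {1}(reindex_inj (addrI x)) /= -sumrN; apply: eq_bigr => y _.
  by rewrite psiD tx mulN1r.
by move=> /eqP; rewrite -addr_eq0 -mulr2n mulrn_eq0 => /eqP.
Qed.

Lemma sum_nonzero_psi : \sum_(x | x != 0) psi x = -1.
Proof. by have /eqP := sum_psi; rewrite (bigD1 0) //= psi0 addrC addr_eq0 => /eqP. Qed.

(** * Multiplicative characters and reduction at a prime above 2 *)

Variable z : algC.
Hypothesis pz : n.-primitive_root z.

Definition omega (x : F) : algC := z ^+ dlog x.

Lemma omegaX k : omega (g ^+ k) = z ^+ k.
Proof. by rewrite /omega dlogX (prim_expr_mod pz). Qed.

Lemma omega1 : omega 1 = 1.
Proof. by rewrite -(expr0 g) omegaX. Qed.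

Lemma omegaM x y : x != 0 -> y != 0 -> omega (x * y) = omega x * omega y.
Proof.
move=> /primitive_root_expP[i ->] /primitive_root_expP[j ->].
by rewrite -exprD !omegaX exprD.
Qed.

Lemma omega_expn x : omega x ^+ n = 1.
Proof. by rewrite -exprM mulnC exprM (prim_expr_order pz) expr1n. Qed.

Lemma sum_omega a : \sum_(x | x != 0) omega x ^+ a = if (n %| a)%N then n%:R else 0.
Proof.
rewrite sum_primitive_powers; under eq_bigr do rewrite omegaX exprAC.
exact: sum_primitive_root_exp.
Qed.

(* The reduction map Z[z] -> F sending z to g, as a relation. *)
Definition reduces (w : algC) (c : F) :=
  exists P : {poly int}, (map_poly intr P).[z] = w /\ (map_poly intr P).[g] = c.

Definition in_Zz (w : algC) := exists c, reduces w c.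

Lemma reduces_inj0 c : reduces 0 c -> c = 0.
Proof. by case=> P [Pz <-]; exact: horner_int_primitive_root pz pg Pz. Qed.

Lemma reducesD v w b c : reduces v b -> reduces w c -> reduces (v + w) (b + c).
Proof. by case=> P [<- <-] [Q [<- <-]]; exists (P + Q); rewrite !rmorphD /= !hornerD. Qed.

Lemma reducesM v w b c : reduces v b -> reduces w c -> reduces (v * w) (b * c).
Proof. by case=> P [<- <-] [Q [<- <-]]; exists (P * Q); rewrite !rmorphM /= !hornerM. Qed.

Lemma reduces_int a : reduces a%:~R a%:~R.
Proof. by exists a%:P; rewrite !map_polyC /= !hornerC. Qed.

Lemma reduces_z : reduces z g.
Proof. by exists 'X; rewrite !map_polyX !hornerX. Qed.

Lemma reduces_exp w c k : reduces w c -> reduces (w ^+ k) (c ^+ k).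
Proof. by case=> P [<- <-]; exists (P ^+ k); rewrite !rmorphXn /= !horner_exp. Qed.

Lemma reduces_omega x : x != 0 -> reduces (omega x) x.
Proof. by move=> nz; rewrite -{2}(dlogK nz); apply/reduces_exp/reduces_z. Qed.

Lemma reduces_sum (I : finType) (P : pred I) (H : I -> algC) (K : I -> F) :
  (forall i, P i -> reduces (H i) (K i)) ->
  reduces (\sum_(i | P i) H i) (\sum_(i | P i) K i).
Proof.
move=> HK; elim/big_rec2: _ => [|i b c Pi IH]; first exact: (reduces_int 0).
exact: reducesD (HK _ Pi) IH.
Qed.

Lemma in_Zz_mul v w : in_Zz v -> in_Zz w -> in_Zz (v * w).
Proof. by move=> [b vb] [c wc]; exists (b * c); exact: reducesM. Qed.

Lemma in_Zz_int a : in_Zz a%:~R.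
Proof. by exists a%:~R; exact: reduces_int. Qed.

Lemma in_Zz_exp w k : in_Zz w -> in_Zz (w ^+ k).
Proof. by move=> [c wc]; exists (c ^+ k); exact: reduces_exp. Qed.

Lemma in_Zz_sum (I : finType) (P : pred I) (H : I -> algC) :
  (forall i, P i -> in_Zz (H i)) -> in_Zz (\sum_(i | P i) H i).
Proof.
move=> HZ; elim/big_rec: _ => [|i v Pi [c vc]]; first exact: (in_Zz_int 0).
by have [b ib] := HZ i Pi; exists (b + c); exact: reducesD.
Qed.

Lemma in_Zz_z : in_Zz z. Proof. by exists g; exact: reduces_z. Qed.

Lemma in_Zz_omega x : in_Zz (omega x).
Proof. exact: in_Zz_exp in_Zz_z. Qed.

(* The prime above 2 given by the reduction map does not divide u, so powers
   of u can be cancelled in a divisibility by powers of 2. *)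
Lemma dvd_exp2_unit_cancel (u : algC) S K (y : int) (w : algC) :
  reduces u 1 -> in_Zz w -> u ^+ S * y%:~R = 2 ^+ K * w ->
  exists y', y = 2 ^+ K * y'.
Proof.
move=> ru; elim: K w => [|K IH] w Zw E; first by exists y; rewrite mul1r.
have [||y' Dy] := IH (2 * w); first exact: (in_Zz_mul (in_Zz_int 2) Zw).
  by rewrite mulrA -exprSr.
have [c wc] := Zw.
have E' : u ^+ S * y'%:~R = 2 * w.
  have nz2 : (2 : algC) ^+ K != 0 by rewrite expf_neq0 // pnatr_eq0.
  apply: (mulfI nz2); rewrite [RHS]mulrA -exprSr -E Dy intrM rmorphXn /=; ring.
(* Reduction sends [u] to 1 and 2 to 0, so y' vanishes in [F]; being an integer, it is even. *)
have r0 : reduces 0 (1 ^+ S * y'%:~R + (-1)%:~R * (2%:~R * c)).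
  have -> : 0 = u ^+ S * y'%:~R + (-1)%:~R * (2%:~R * w) :> algC by rewrite E'; ring.
  apply: reducesD; first by apply: reducesM (reduces_int _); apply: reduces_exp.
  by do 2!apply: reducesM (reduces_int _) _.
have := reduces_inj0 r0; rewrite expr1n mul1r.
have -> : 2%:~R = 0 :> F by rewrite -[2%:~R]/(2%:R) (pcharf0 pchar2).
rewrite mul0r mulr0 addr0 => y'0.
have : (2 %| `|y'|)%N.
  rewrite (dvdn_pcharf pchar2); case: y' {Dy E' r0} y'0 => k.
    by rewrite absz_nat => /eqP.
  by rewrite NegzE mulrNz abszN absz_nat => /eqP; rewrite oppr_eq0.
move=> /dvdnP[k Dk]; exists (sgz y' * k%:Z).
by rewrite Dy [in LHS](intEsg y') Dk exprSr PoszM; ring.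
Qed.

(** * Gauss and Jacobi sums *)

Definition gauss a : algC := \sum_(x | x != 0) (psi x)%:~R * omega x ^+ a.

Lemma gauss_modn a : gauss (a %% n) = gauss a.
Proof.
by apply: eq_bigr => x _; rewrite (expr_mod _ (omega_expn x)).
Qed.

Lemma gauss0 : gauss 0 = -1.
Proof.
have : (\sum_(x | x != 0) psi x)%:~R = -1 :> algC by rewrite sum_nonzero_psi.
by rewrite rmorph_sum /= => <-; apply: eq_bigr => x _; rewrite mulr1.
Qed.

(** Squaring permutes [F] and preserves [psi]. *)
Lemma gauss_double a : gauss (2 * a) = gauss a.
Proof.
have inj2 : injective (fun x : F => x ^+ 2).
  by move=> x y /=; rewrite -!(pFrobenius_autE pchar2); exact: fmorph_inj.
rewrite [RHS](reindex_inj inj2) /=; apply: eq_big => [x|x nz_x].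
  by rewrite expf_eq0.
by rewrite psi_sqr exprM expr2 -omegaM // -expr2.
Qed.

(* The usual Jacobi sum of omega x ^+ a * omega (1 - x) ^+ b, after
   the substitution x = 1 / (1 + t). *)
Definition jacobi a b : algC :=
  \sum_(t | (t != 0) && (t != 1)) omega t ^+ b * omega (1 + t) ^+ (n.-1 * (a + b)).

Lemma in_Zz_jacobi a b : in_Zz (jacobi a b).
Proof. by apply: in_Zz_sum => t _; apply: in_Zz_mul; apply: in_Zz_exp; apply: in_Zz_omega. Qed.

(** The second factor is trivial, leaving a complete nontrivial character sum without its term at t
    = 1. *)
Lemma jacobi_opp a b : (n %| a + b)%N -> ~~ (n %| b)%N -> jacobi a b = -1.
Proof.
move=> /dvdnP[c Dc] nb; have := sum_omega b; rewrite (negbTE nb).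
rewrite (bigD1 1) ?oner_neq0 //= omega1 expr1n => /eqP.
rewrite addrC addr_eq0 => /eqP <-; apply: eq_bigr => t _.
by rewrite Dc mulnA mulnC exprM omega_expn expr1n mulr1.
Qed.

(** Substitute y = x t. At t = 1 the argument 1 + t vanishes in characteristic 2, which leaves a
    bare character sum; otherwise x is rescaled by 1 + t, and the exponent [n.-1] inverts the
    character. *)
Lemma gaussM a b :
  gauss a * gauss b = (if (n %| a + b)%N then n%:R else 0) + jacobi a b * gauss (a + b).
Proof.
rewrite /gauss mulr_suml.
have E1 x : x != 0 -> (psi x)%:~R * omega x ^+ a *
    (\sum_(y | y != 0) (psi y)%:~R * omega y ^+ b)
  = \sum_(t | t != 0) (psi (x * (1 + t)))%:~R * omega x ^+ (a + b) * omega t ^+ b.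
  move=> nz_x; rewrite (reindex_inj (mulfI nz_x)) mulr_sumr /=.
  apply: eq_big => [t|t]; first by rewrite mulf_eq0 (negbTE nz_x).
  rewrite mulf_eq0 (negbTE nz_x) /= => nz_t.
  by rewrite mulrDr mulr1 psiD intrM omegaM // exprMn exprD; ring.
rewrite (eq_bigr _ E1) exchange_big /= (bigD1 1) ?oner_neq0 //=; congr (_ + _).
  under eq_bigr do rewrite (addrr_pchar2 pchar2) mulr0 psi0 omega1 expr1n mulr1 mul1r.
  exact: sum_omega.
rewrite mulr_suml; apply: eq_bigr => t /andP[nz_t t1].
have nz_t1 : 1 + t != 0.
  by rewrite addr_eq0 (oppr_pchar2 pchar2) eq_sym.
rewrite -mulr_suml -mulrA mulrC; congr (_ * _).
rewrite [in RHS](reindex_inj (mulIf nz_t1)) mulr_sumr /=.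
apply: eq_big => [x|x nz_x]; first by rewrite mulf_eq0 (negbTE nz_t1) orbF.
rewrite omegaM // exprMn mulrCA; congr (_ * _).
by rewrite mulrCA -exprD -mulSnr prednK // exprM omega_expn expr1n mulr1.
Qed.

Lemma gauss_norm a : ~~ (n %| a)%N -> gauss (n.-1 * a) * gauss a = (2 ^ f)%:R.
Proof.
move=> na; have Ea : (n.-1 * a + a = n * a)%N by rewrite -mulSnr prednK.
have dvdE : (n %| n.-1 * a + a)%N by rewrite Ea dvdn_mulr.
rewrite gaussM dvdE jacobi_opp // Ea -gauss_modn mulnC modnMl gauss0.
by rewrite mulrNN mulr1 -pred_exp2K -natr1.
Qed.

(* The exponent on the left is the binary weight of A K, whose bits are produced
   by the doubling sequence A. With gauss_norm, this is the lower bound in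
   Stickelberger's theorem. *)
Lemma gauss_exp_binary_weight (A : nat -> nat) K :
  A 0%N = 0%N -> (forall k, (2 * A k <= A k.+1 <= (2 * A k).+1)%N) ->
  (forall k, (k <= K)%N -> (A k < n)%N) ->
  exists J, in_Zz J /\
    gauss n.-1 ^+ (\sum_(k < K) (A k.+1 - 2 * A k)) = J * gauss (n.-1 * A K).
Proof.
move=> A0 step; elim: K => [|K IH] ltA.
  exists (-1); split; first exact: (in_Zz_int (-1)).
  by rewrite big_ord0 A0 muln0 gauss0 mulN1r opprK.
have [k le_kK|J [ZJ E]] := IH; first by apply: ltA; rewrite leqW.
rewrite big_ord_recr /= exprD E.
have /andP[lo hi] := step K.
have [eqA|neqA] := eqVneq (A K.+1) (2 * A K)%N.
  by exists J; rewrite eqA subnn mulr1 mulnCA gauss_double.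
have eqA : A K.+1 = (2 * A K).+1 by lia.
have E' := gaussM (n.-1 * (2 * A K)) n.-1; set J' := jacobi _ _ in E'.
exists (J * J'); split; first exact: in_Zz_mul ZJ (in_Zz_jacobi _ _).
have Ei : (n.-1 * (2 * A K) + n.-1 = n.-1 * A K.+1)%N by rewrite eqA mulnS addnC.
rewrite Ei mulnCA gauss_double in E'.
rewrite {1}eqA subSnn expr1 -mulrA E'.
(* The exceptional term of [gaussM] would require [n] to divide [A K.+1], which lies strictly
   between 0 and [n]. *)
case: ifP => [dvd|_]; last by rewrite add0r mulrA.
have := dvd; rewrite -[n in (n %| _)%N]prednK // Gauss_dvdr ?coprimeSn //.
rewrite prednK // => /dvdn_leq; rewrite eqA => /(_ isT); rewrite -eqA.
by rewrite leqNgt ltA.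
Qed.

(** Let [u] be the part of the character sum where the trace is 1. The whole sum is 0, so the signs
    of [psi] leave -2 [u], and [u] reduces to [sum_trace2_inv]. *)
Lemma gauss_neg1 : exists u, reduces u 1 /\ gauss n.-1 = - 2 * u.
Proof.
pose u := \sum_(x | (x != 0) && (trace2 x != 0)) omega x ^+ n.-1.
exists u; split.
  rewrite -sum_trace2_inv (bigID (fun x => trace2 x == 0)) /= big1; last first.
    by move=> x /andP[_ /eqP->]; rewrite mul0r.
  rewrite add0r; apply: reduces_sum => x /andP[nz_x t_x].
  by rewrite trace2E t_x mul1r; apply/reduces_exp/reduces_omega.
have : \sum_(x | x != 0) omega x ^+ n.-1 = 0.
  by rewrite sum_omega gtnNdvd // ?prednK // -ltnS prednK // pred_exp2_gt1.
rewrite (bigID (fun x => trace2 x != 0)) /= -/u => /eqP; rewrite addrC addr_eq0 => /eqP E.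
rewrite /gauss (bigID (fun x => trace2 x != 0)) /=.
have -> : \sum_(x | (x != 0) && (trace2 x != 0)) (psi x)%:~R * omega x ^+ n.-1 = - u.
  rewrite -sumrN; apply: eq_bigr => x /andP[_ /negbTE tx].
  by rewrite /psi tx mulN1r.
rewrite (eq_bigr (fun x => omega x ^+ n.-1)) ?E; first by ring.
by move=> x /andP[_]; rewrite negbK /psi => ->; rewrite mul1r.
Qed.

End AdditiveCharacter.

(** * Cayley graphs with two nontrivial eigenvalues *)

Section TwoEigenvalues.
Variables (F : finFieldType) (f : nat).
Hypotheses (cardF : #|F| = (2 ^ f)%N).
Hypothesis sum_psi0 : \sum_(x : F) psi f x = 0.
Local Notation psi := (psi f).
Local Notation q := (2 ^ f)%N.

Lemma sum_psiM (b : F) : \sum_a psi (a * b) = if b == 0 then q%:Z else 0.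
Proof.
case: eqP => [->|/eqP nz_b].
  by under eq_bigr do rewrite mulr0 psi0; rewrite sumr_const -cardF natz.
by rewrite -[RHS]sum_psi0 [RHS](reindex_inj (mulIf nz_b)).
Qed.

Variable D : {set F}.

Definition cay_eigenvalue (a : F) : int := \sum_(y in D) psi (a * y).

Lemma cay_eigenvalue0 : cay_eigenvalue 0 = #|D|%:Z.
Proof.
by rewrite /cay_eigenvalue; under eq_bigr do rewrite mul0r psi0; rewrite sumr_const natz.
Qed.

Lemma addr_eq0_pchar2 (x y : F) : (x + y == 0) = (x == y).
Proof. by rewrite addr_eq0 (oppr_pchar2 (pchar2 cardF)). Qed.

Lemma sum_cay_eigenvalue_psi (b : F) :
  \sum_a cay_eigenvalue a * psi (a * b) = q%:Z * (b \in D)%:Z.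
Proof.
under eq_bigr do rewrite mulr_suml.
rewrite exchange_big /=.
under eq_bigr => y _ do (under eq_bigr => a _ do rewrite -psiD // -mulrDr;
  rewrite sum_psiM addr_eq0_pchar2).
case: (boolP (b \in D)) => bD; last first.
  by rewrite mulr0 big1 // => y yD; case: eqP => // Dy; rewrite Dy (negbTE bD) in yD.
rewrite (bigD1 b) //= eqxx big1 ?addr0 ?mulr1 // => y /andP[_ /negbTE ->] //.
Qed.

(** One factor is expanded over [D] and Fourier inversion is applied to the other. The case b = 0 is
    Parseval. *)
Lemma sum_cay_eigenvalue_sqr_psi (b : F) :
  \sum_a cay_eigenvalue a ^+ 2 * psi (a * b) = q%:Z * #|[set u in D | u + b \in D]|%:Z.
Proof.
have E a : cay_eigenvalue a ^+ 2 * psi (a * b)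
    = \sum_(u in D) cay_eigenvalue a * psi (a * (u + b)).
  rewrite expr2 {2}/cay_eigenvalue mulrAC mulrC -mulr_sumr mulrC.
  by rewrite -mulrA; congr (_ * _); rewrite mulr_sumr; apply: eq_bigr => u _;
     rewrite mulrDr psiD // mulrC.
under eq_bigr do rewrite E.
rewrite exchange_big /=; under eq_bigr do rewrite sum_cay_eigenvalue_psi.
rewrite -mulr_sumr; congr (_ * _); rewrite -[RHS]natz -sum1_card natr_sum.
under [RHS]eq_bigl do rewrite inE.
by rewrite [RHS]big_mkcondr /=; apply: eq_bigr => u _; case: (_ \in D).
Qed.

(* When the eigenvalues at nonzero frequencies are roots of one quadratic, the
   inverse Fourier transform of their squares, which counts the solutions of
   u + v = b in D, is affine in the indicator of D. *)
Lemma strongly_regular_two_eigenvalues (s c d : int) (y0 z0 : F) :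
  s != 0 -> (forall a, a != 0 -> (s * cay_eigenvalue a + c) ^+ 2 = d) ->
  0 \notin D -> y0 \in D -> z0 != 0 -> z0 \notin D -> strongly_regular (Cay D).
Proof.
move=> nz_s quad D0 Dy0 nz_z0 Dz0.
pose common b := #|[set u in D | u + b \in D]|.
have commonE b : b != 0 ->
    s ^+ 2 * (q%:Z * (common b)%:Z) = s ^+ 2 * #|D|%:Z ^+ 2 - (d - c ^+ 2)
      + 2 * s * c * #|D|%:Z - 2 * s * c * (q%:Z * (b \in D)%:Z).
  move=> nz_b; rewrite -sum_cay_eigenvalue_sqr_psi (bigD1 0) //= cay_eigenvalue0 mul0r psi0 mulr1.
  rewrite -sum_cay_eigenvalue_psi [in RHS](bigD1 0) //= cay_eigenvalue0 mul0r psi0 mulr1.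
  have := sum_psiM b; rewrite (negbTE nz_b) (bigD1 0) //= mul0r psi0 => E1.
  have {}E1 : \sum_(a | a != 0) psi (a * b) = -1.
    by apply/eqP; rewrite -addr_eq0 addrC E1.
  have E2 : \sum_(a | a != 0) (s ^+ 2 * (cay_eigenvalue a ^+ 2 * psi (a * b)))
    = \sum_(a | a != 0) ((d - c ^+ 2) * psi (a * b)
        - 2 * s * c * (cay_eigenvalue a * psi (a * b))).
    by apply: eq_bigr => a /quad <-; ring.
  rewrite -mulr_sumr sumrB -!mulr_sumr E1 in E2.
  by rewrite mulrDr E2; ring.
have nz_q : s ^+ 2 * q%:Z != 0 by rewrite mulf_neq0 ?expf_neq0 // gt_eqF // ltz_nat expn_gt0.
have common_eq b b' : b != 0 -> b' != 0 -> (b \in D) = (b' \in D) -> common b = common b'.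
  move=> nz_b nz_b' bb'; have := commonE b nz_b; rewrite bb' -commonE // !mulrA.
  by move/(mulfI nz_q) => [].
have sub_add (x y : F) : x - y = x + y by rewrite (oppr_pchar2 (pchar2 cardF)).
have mem_translate x w (A : {set F}) : (w \in [set x + u | u in A]) = (x + w \in A).
  rewrite -{1}(subrK x w) addrC sub_add (addrC w) mem_imset //; exact: addrI.
(* Signs being immaterial in characteristic 2, translation by x carries the counted subset of [D]
   onto the common neighbors. *)
have commonP x y : #|common_neighbors (Cay D) x y| = common (x + y).
  rewrite /common -(card_imset _ (@addrI _ x)); apply: eq_card => w.
  rewrite mem_translate !inE /Cay !sub_add addrA -[x + x]sub_add subrr add0r.
  by congr (_ && (_ \in D)); ring.
exists #|F|, #|D|, (common y0), (common z0); split.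
- split=> //.
    split=> x; first by move=> y; rewrite /Cay !sub_add addrC.
    by rewrite /Cay subrr (negbTE D0).
  move=> x; rewrite -(card_imset D (@addrI _ x)); apply: eq_card => w.
  by rewrite mem_translate inE /Cay sub_add.
- by exists z0, 0; rewrite /Cay subr0.
- by exists y0, 0; rewrite /Cay subr0.
- move=> x y xy; rewrite commonP; rewrite /Cay sub_add in xy.
  have nz : x + y != 0 by apply: contraNneq D0 => <-.
  by apply: common_eq; rewrite ?xy ?Dy0 //; apply: contraNneq D0 => <-.
- move=> x y nxy xy; rewrite commonP; rewrite /Cay sub_add in xy.
  by apply: common_eq; rewrite ?addr_eq0_pchar2 // (negbTE xy) (negbTE Dz0).
Qed.
End TwoEigenvalues.

(** * Cyclotomic classes of order p^(m+1) *)

Section MersenneCyclotomic.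
Variables (p r m : nat).
Hypotheses (pr_p : prime p) (p2r : p.+1 = (2 ^ r)%N).
Local Notation l := (p ^ m)%N.
Local Notation N := (p ^ m.+1)%N.
Local Notation f := (r * p ^ m)%N.
Local Notation n := (2 ^ f).-1.
Variables (F : finFieldType) (g : F).
Hypotheses (cardF : #|F| = (2 ^ f)%N) (pg : n.-primitive_root g).
Local Notation L := (n %/ N)%N.

Let l_gt0 : (0 < l)%N. Proof. by rewrite expn_gt0 prime_gt0. Qed.
Let N_gt0 : (0 < N)%N. Proof. by rewrite expn_gt0 prime_gt0. Qed.

Let f_gt1 : (1 < f)%N.
Proof. by rewrite (leq_trans (mersenne_exp_gt1 pr_p p2r)) // leq_pmulr. Qed.

Let n_gt0 : (0 < n)%N := ltnW (pred_exp2_gt1 f_gt1).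

Let dvd_Nn : (N %| n)%N. Proof. by rewrite (dvdn_pred_exp2 pr_p p2r). Qed.

Let NL : (N * L = n)%N. Proof. by rewrite mulnC divnK. Qed.

Let L_gt0 : (0 < L)%N. Proof. by rewrite divn_gt0 // dvdn_leq. Qed.

Let odd_l : odd l. Proof. by rewrite oddX (mersenne_odd pr_p p2r) orbT. Qed.

(** * Divisibility of Gauss sums of exact order N by powers of 2 *)

Section Divisibility.
Variable z : algC.
Hypothesis pz : n.-primitive_root z.
Local Notation gauss := (gauss g f_gt1 z).
Local Notation omega := (omega g f_gt1 z).
Local Notation in_Zz := (in_Zz g z).

(** With W the binary weight of j L, (-2 u)^W is a multiple of the Gauss sum at -j L. Multiplying by
    the one at j L gives 2^f, and f = S + h + 1 with W at most S = r - 1 + h and h = [r * l./2].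
    Using u^S rather than u^W makes the exponent of [u] independent of [j]. *)
Lemma gauss_mersenne_dvd u j :
  reduces g z u 1 -> gauss n.-1 = - 2 * u -> ~~ (p %| j)%N -> (j < N)%N ->
  exists w, in_Zz w /\
    u ^+ (r.-1 + r * l./2) * gauss (j * L) = 2 ^+ (r * l./2).+1 * w.
Proof.
move=> ru gu npj ltj.
pose A k := (2 ^ k * j %/ N)%N.
have j_gt0 : (0 < j)%N by rewrite lt0n; apply: contraNneq npj => ->; rewrite dvdn0.
have Af : A f = (j * L)%N.
  have E2f : (2 ^ f = L * N + 1)%N by rewrite (mulnC L) NL addn1 pred_exp2K.
  rewrite /A [X in (X * j)%N]E2f; have -> : ((L * N + 1) * j = j * L * N + j)%N by ring.
  by rewrite divnMDl // (divn_small ltj) addn0.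
have Alt k : (k <= f)%N -> (A k < n)%N.
  move=> le_kf; apply: (@leq_ltn_trans (A f)).
    by rewrite leq_div2r // leq_mul2r leq_pexp2l ?orbT.
  by rewrite Af -[X in (_ < X)%N]NL ltn_pmul2r.
have A0 : A 0%N = 0%N by rewrite /A expn0 mul1n (divn_small ltj).
have step k : (2 * A k <= A k.+1 <= (2 * A k).+1)%N.
  rewrite /A (expnS 2 k) -(mulnA 2); set x := (2 ^ k * j)%N.
  have Ex := divn_eq x N; have := ltn_pmod x N_gt0.
  move: (x %/ N)%N (x %% N)%N Ex => c b -> ltb.
  apply/andP; split; first by rewrite leq_divRL // mulnDr mulnA leq_addr.
  by rewrite -ltnS ltn_divLR //; nia.
have [J [ZJ E]] := gauss_exp_binary_weight cardF pg f_gt1 pz A0 step Alt.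
have := binary_weight_le pr_p p2r npj ltj; rewrite -/(A _) in E *.
set W := (\sum_(k < f) _)%N in E *; rewrite -[X in (X <= _)%N -> _]/W => leW.
have na : ~~ (n %| j * L)%N by rewrite gtnNdvd ?muln_gt0 ?j_gt0 // -Af Alt.
have norm := gauss_norm cardF pg f_gt1 pz na.
set S := (_ + _)%N in leW *; set h := (r * l./2)%N in S leW *.
have fE : f = (S + h.+1)%N.
  have r_gt0 : (0 < r)%N by exact: ltnW (mersenne_exp_gt1 pr_p p2r).
  have {1}-> : l = (1 + l./2 * 2)%N by rewrite muln2 -[in LHS](odd_double_half l) odd_l.
  rewrite /S /h addnS -addSn -[in RHS]addSn prednK //.
  by move: (l./2) => t; ring.
clearbody S; have SW : S = (S - W + W)%N by rewrite subnK.
exists (u ^+ (S - W) * (-1) ^+ W * J * 2 ^+ (S - W)); split.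
  apply: in_Zz_mul; last exact: in_Zz_exp (in_Zz_int g z 2).
  apply: in_Zz_mul => //; apply: in_Zz_mul; last exact: in_Zz_exp (in_Zz_int g z (-1)).
  by apply: in_Zz_exp; exists 1.
have nz2 : (- 2 : algC) ^+ W != 0 by rewrite expf_neq0 // oppr_eq0 pnatr_eq0.
apply: (mulfI nz2).
have -> : (- 2) ^+ W * (u ^+ S * gauss (j * L))
    = u ^+ (S - W) * ((- 2 * u) ^+ W * gauss (j * L)).
  by rewrite {1}SW exprD exprMn; ring.
rewrite -gu E Af -[X in _ * X]mulrA norm natrX [X in 2 ^+ X]fE exprD [X in 2 ^+ X * _]SW exprD.
have -> : (-2 : algC) = -1 * 2 by ring.
rewrite exprMn.
have -> : (-1) ^+ W * 2 ^+ W * (2 ^+ h.+1 * (u ^+ (S - W) * (-1) ^+ W * J * 2 ^+ (S - W)))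
  = ((-1) ^+ W * (-1) ^+ W) *
    (u ^+ (S - W) * (J * (2 ^+ (S - W) * 2 ^+ W * 2 ^+ h.+1))) :> algC by ring.
by rewrite -expr2 sqrr_sign mul1r.
Qed.

End Divisibility.

(** * Fourier expansion of the union of classes *)

Local Notation D := (\bigcup_(i < l) cyclotomic_class g N i)%SET.

Lemma mem_cyclotomic_union k : (g ^+ k \in D) = (k %% N < l)%N.
Proof.
have eq_modN a b : g ^+ a = g ^+ b -> (a = b %[mod N])%N.
  move/eqP; rewrite (eq_prim_root_expr pg) => /eqP E.
  by rewrite -(modn_dvdm _ dvd_Nn) E modn_dvdm.
have lN : (l <= N)%N by rewrite leq_pexp2l ?prime_gt0.
apply/bigcupP/idP => [[i _ /imsetP[j _ /eq_modN ->]]|ltk].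
  by rewrite addnC modnMDl modn_small // (leq_trans _ lN).
exists (Ordinal ltk) => //; apply/imsetP.
have ltL : ((k %% n) %/ N < #|F|.-1 %/ N)%N.
  by rewrite cardF ltn_divLR // divnK // ltn_mod.
exists (Ordinal ltL) => //=; rewrite -(modn_dvdm k dvd_Nn) addnC -divn_eq.
by rewrite (prim_expr_mod pg).
Qed.

Lemma zero_notin_cyclotomic_union : 0 \notin D.
Proof.
apply/bigcupP => [[i _ /imsetP[j _ /esym/eqP]]].
by rewrite expf_eq0 (negbTE (primitive_root_neq0 pg f_gt1)) andbF.
Qed.

Local Notation Psi := (cay_eigenvalue f D).

Lemma sum_cyclotomic_union (V : nmodType) (H : F -> V) :
  \sum_(y in D) H y = \sum_(k < n) if (k %% N < l)%N then H (g ^+ k) else 0.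
Proof.
transitivity (\sum_(y | y != 0) if y \in D then H y else 0).
  rewrite -big_mkcondr; apply: eq_bigl => y.
  by case: eqP => //= ->; rewrite (negbTE zero_notin_cyclotomic_union).
by rewrite (sum_primitive_powers cardF pg f_gt1); under eq_bigr do rewrite mem_cyclotomic_union.
Qed.

(** As [N] divides [n], the factor [n.-1] acts as -1 mod [N]: the condition says that k is i mod
    [N]. *)
Lemma sum_residue_indicator (k : nat) (R : nzRingType) :
  \sum_(i < l) (if (N %| k + n.-1 * i)%N then N%:R else 0) =
    if (k %% N < l)%N then N%:R else 0 :> R.
Proof.
have lN : (l <= N)%N by rewrite leq_pexp2l ?prime_gt0.
have E (i : 'I_l) : (N %| k + n.-1 * i)%N = (k %% N == i)%N.
  have iN : (i < N)%N by apply: leq_trans lN.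
  have /dvdnP[c Dc] := dvd_Nn.
  rewrite /dvdn -[X in _ == X](mod0n N) -(eqn_modDr i) add0n -addnA -mulSnr prednK //.
  by rewrite Dc mulnAC addnC modnMDl (modn_small iN).
under eq_bigr do rewrite E; case: ifP => lk.
  rewrite (bigD1 (Ordinal lk)) //= eqxx big1 ?addr0 // => i.
  by rewrite -val_eqE eq_sym => /negbTE ->.
by rewrite big1 // => i _; case: eqP lk => // ->; rewrite ltn_ord.
Qed.

(* Only characters of exact order N survive in the Fourier expansion of D: the
   inner sum vanishes for j divisible by p, except at j = 0. *)
Lemma cay_eigenvalue_gauss z a : n.-primitive_root z -> a != 0 ->
  (l%:Z * (p%:Z * Psi a + 1))%:~R =
  \sum_(j < N | ~~ (p %| j)%N) gauss g f_gt1 z (j * L) *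
     \sum_(i < l) omega g f_gt1 z (a * g ^+ i) ^+ (n.-1 * (j * L)).
Proof.
move=> pz nz_a; pose om := omega g f_gt1 z.
pose c j := \sum_(i < l) om (a * g ^+ i) ^+ (n.-1 * (j * L)).
have nz_g : g != 0 := primitive_root_neq0 pg f_gt1.
have omE i : om (a * g ^+ i) = om a * z ^+ i.
  by rewrite /om omegaM ?expf_neq0 // omegaX.
(* Summing over all characters of order dividing [N] recovers the indicator of [D] by
   orthogonality. *)
have E : \sum_(j < N) gauss g f_gt1 z (j * L) * c j = (N%:Z * Psi a)%:~R.
  have pw := dvdn_prim_root pz dvd_Nn; rewrite -/L in pw.
  transitivity (\sum_(j < N) \sum_(k < n) \sum_(i < l)
      (psi f (a * g ^+ k))%:~R * ((z ^+ L) ^+ (k + n.-1 * i)) ^+ j).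
    apply: eq_bigr => j _; rewrite /gauss (reindex_inj (mulfI nz_a)) /=.
    under eq_bigl do rewrite mulf_eq0 (negbTE nz_a) /=.
    rewrite (sum_primitive_powers cardF pg f_gt1) mulr_suml; apply: eq_bigr => k _.
    rewrite -mulrA -mulr_sumr; congr (_ * _); rewrite mulr_sumr.
    apply: eq_bigr => i _; rewrite -/om !omE !exprMn mulrACA -exprD -mulSn prednK //.
    rewrite exprM (omega_expn g f_gt1 pz) expr1n mul1r -!exprM -exprD; congr (_ ^+ _).
    by ring.
  rewrite exchange_big /= /cay_eigenvalue sum_cyclotomic_union mulr_sumr rmorph_sum /=.
  apply: eq_bigr => k _; rewrite exchange_big /=.
  under eq_bigr do rewrite -mulr_sumr (sum_primitive_root_exp _ pw).
  rewrite -mulr_sumr sum_residue_indicator; case: ifP => _; last by rewrite !mulr0.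
  by rewrite rmorphM mulrC.
(* The term j = 0 is -l. For j = p j' with j' nonzero, [c j] is a multiple of a complete sum of
   powers of a nontrivial l-th root of unity, hence 0. *)
have c0 : \sum_(j < N | (p %| j)%N) gauss g f_gt1 z (j * L) * c j = - l%:R.
  rewrite (bigD1 (Ordinal N_gt0)) ?dvdn0 //= big1 ?addr0 => [|j /andP[/dvdnP[j' Dj] nz_j]].
    rewrite mul0n gauss0 // mulN1r /c mul0n muln0.
    by under eq_bigr do rewrite expr0; rewrite sumr_const card_ord.
  have pw := dvdn_prim_root pz (dvdn_trans (dvdn_exp2l p (leqnSn m)) dvd_Nn).
  have Dw : (n %/ l = p * L)%N.
    by rewrite -[X in (X %/ l)%N]NL expnS mulnAC mulnK.
  have EX : (n.-1 * (j * L) = n %/ l * (n.-1 * j'))%N by rewrite Dw Dj; ring.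
  rewrite /c; under eq_bigr => i _ do rewrite omE EX exprMn (exprAC z i) (exprM z).
  rewrite -mulr_sumr (sum_primitive_root_exp _ pw).
  have -> : (l %| n.-1 * j')%N = false.
    rewrite Gauss_dvdr; last first.
      rewrite coprime_sym (coprime_dvdr (dvdn_trans (dvdn_exp2l p (leqnSn m)) dvd_Nn)) //.
      by rewrite -[X in coprime _ X]prednK // coprimenS.
    apply/negbTE; rewrite gtnNdvd //; last first.
      by rewrite -(ltn_pmul2r (prime_gt0 pr_p)) -Dj -expnSr.
    by rewrite lt0n; apply: contra nz_j => /eqP j0; rewrite -val_eqE /= Dj j0.
  by rewrite !mulr0.
have EN : (l%:Z * (p%:Z * Psi a + 1)) = N%:Z * Psi a + l%:Z by rewrite expnSr PoszM; ring.
rewrite EN rmorphD /= -E (bigID (fun j : 'I_N => (p %| j)%N)) /= c0.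
by rewrite addrAC addNr add0r.
Qed.

Local Notation M := (2 ^+ (r * l./2) : int).

(** Each term of the Gauss sum expansion carries the power of 2 once multiplied by a common power of
    [u]. That power is then cancelled by reduction, and the factor [l] because it is odd. *)
Lemma cay_eigenvalue_dvd a : a != 0 ->
  exists w, p%:Z * Psi a + 1 = 2 ^+ (r * l./2).+1 * w.
Proof.
move=> nz_a; have [z pz] := C_prim_root_exists n_gt0.
have [u [ru gu]] := gauss_neg1 cardF pg f_gt1 pz.
set h := (r * l./2)%N.
have [w [Zw Ew]] : exists w, in_Zz g z w /\
    u ^+ (r.-1 + h) * (l%:Z * (p%:Z * Psi a + 1))%:~R = 2 ^+ h.+1 * w.
  rewrite (cay_eigenvalue_gauss pz nz_a) mulr_sumr.
  apply: (big_ind (fun v => exists w, in_Zz g z w /\ v = 2 ^+ h.+1 * w)).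
  - by exists 0; rewrite mulr0; split => //; exact: (in_Zz_int g z 0).
  - move=> v1 v2 [w1 [[c1 Z1] ->]] [w2 [[c2 Z2] ->]]; exists (w1 + w2).
    by rewrite mulrDr; split => //; exists (c1 + c2); exact: reducesD.
  move=> j npj; have [w [Zw Ew]] := gauss_mersenne_dvd pz ru gu npj (ltn_ord j).
  rewrite mulrA Ew -mulrA; eexists; split; last by [].
  apply: in_Zz_mul Zw _; apply: in_Zz_sum => i _; apply: in_Zz_exp.
  exact: in_Zz_omega.
have [y Ey] := dvd_exp2_unit_cancel cardF pg pz ru Zw Ew.
have lE : l%:Z = 1 + 2 * (l./2)%:Z.
  by rewrite -[in LHS](odd_double_half l) odd_l PoszD -mul2n PoszM.
have /dvdzP[w' Dw'] : (2 ^+ h.+1 %| p%:Z * Psi a + 1)%Z.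
  have : (2 ^+ h.+1 %| l%:Z * (p%:Z * Psi a + 1))%Z by rewrite Ey dvdz_mulr.
  by rewrite Gauss_dvdzr // coprimezXl // coprimezE /= coprime2n.
by exists w'; rewrite Dw' mulrC.
Qed.

(* Integrality: p * Psi a + 1 is divisible by 2 M and congruent to M mod p. *)
Lemma cay_eigenvalue_mod_mersenne a : a != 0 ->
  exists y, p%:Z * Psi a + 1 = M * (p%:Z * (2 * y + 1) + 1).
Proof.
move=> /cay_eigenvalue_dvd[w Ew].
have [t Mt] : exists t, M = 1 + p%:Z * t.
  have [k Ek] := exp_succ_mod_sq p l./2; exists ((l./2)%:Z + p%:Z * k%:Z).
  have -> : M = (p.+1 ^ l./2)%:Z by rewrite p2r -expnM -natz natrX natz.
  by rewrite Ek; ring.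
have [p' Dp] : exists p' : nat, p = (2 * p' + 1)%N.
  by exists p./2; rewrite -[LHS]odd_double_half (mersenne_odd pr_p p2r) addnC mul2n.
rewrite exprSr in Ew; pose X := Psi a - 2 * t * w.
have EX : 2 * w = p%:Z * X + 1 by rewrite /X; rewrite Mt in Ew; lia.
(* From 2 w = p X + 1 and p = 2 p' + 1 it follows that X = 2 (w - 1 - p' X) + 1. *)
exists (w - 1 - p'%:Z * X); rewrite Ew -mulrA EX; congr (_ * (_ * _ + 1)).
by rewrite Dp in EX; lia.
Qed.

Lemma card_cyclotomic_union : (p * #|D| = n)%N.
Proof.
have count t : (\sum_(k < N * t) (if k %% N < l then 1 else 0) = l * t)%N.
  elim: t => [|t IH]; first by rewrite !muln0 big_ord0.
  rewrite mulnS addnC big_split_ord /= IH mulnS addnC; congr (_ + _)%N.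
  under eq_bigr => i _ do rewrite mulnC modnMDl (modn_small (ltn_ord i)).
  have lN : (l <= N)%N by rewrite leq_pexp2l ?prime_gt0.
  by rewrite -big_mkcond /= -(big_ord_widen _ (fun=> 1%N) lN) sum_nat_const card_ord muln1.
have : (\sum_(y in D) 1 = l * L)%N.
  by rewrite (sum_cyclotomic_union (fun=> 1%N)) -count NL.
by rewrite sum1_card => ->; rewrite mulnA -expnS NL.
Qed.

(** The difference [T] of the two sides is (p M)^2 (X^2 - 1) with X odd, hence nonnegative. The
    first two moments of [Psi] make the sum of [T] over nonzero arguments 0, so every term
    vanishes. *)
Lemma cay_eigenvalue_quadratic a : a != 0 ->
  (p%:Z * Psi a + (1 - M)) ^+ 2 = (p%:Z * M) ^+ 2.
Proof.
move=> nz_a; pose T b := (p%:Z * Psi b + (1 - M)) ^+ 2 - (p%:Z * M) ^+ 2.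
have T_ge0 b : b != 0 -> 0 <= T b.
  move=> /cay_eigenvalue_mod_mersenne[y Ey].
  have -> : T b = (p%:Z * M) ^+ 2 * (4 * (y * (y + 1))).
    have -> : T b = (p%:Z * Psi b + 1 - M) ^+ 2 - (p%:Z * M) ^+ 2 by rewrite /T; ring.
    by rewrite Ey; ring.
  by rewrite mulr_ge0 ?sqr_ge0 //; nia.
suff T0 : \sum_(b | b != 0) T b = 0.
  by apply/eqP; rewrite -subr_eq0; apply/eqP; apply: (psumr_eq0P T_ge0 T0).
have sum0 := sum_psi cardF pg f_gt1.
have S1 : \sum_b Psi b = 0.
  have := sum_cay_eigenvalue_psi cardF sum0 D 0.
  rewrite (negbTE zero_notin_cyclotomic_union) mulr0; apply: etrans.
  by apply: eq_bigr => b _; rewrite mulr0 psi0 mulr1.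
have S2 : \sum_b Psi b ^+ 2 = (2 ^ f)%:Z * #|D|%:Z.
  have setE : [set v in D | v + 0 \in D] = D.
    by apply/setP => v; rewrite inE addr0 andbb.
  have := sum_cay_eigenvalue_sqr_psi cardF sum0 D 0; rewrite setE; apply: etrans.
  by apply: eq_bigr => b _; rewrite mulr0 psi0 mulr1.
rewrite (bigD1 0) //= cay_eigenvalue0 in S1; rewrite (bigD1 0) //= cay_eigenvalue0 in S2.
have Dcard : p%:Z * #|D|%:Z = (2 ^ f)%:Z - 1.
  by rewrite -PoszM card_cyclotomic_union -(pred_exp2K f); lia.
have Dq : (2 ^ f)%:Z = (p%:Z + 1) * M ^+ 2.
  have -> : p%:Z + 1 = (2 ^ r)%:Z by rewrite -p2r; lia.
  rewrite -!natz !natrX -exprM -exprD natz; congr (_ ^+ _).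
  have {1}-> : l = (1 + l./2 * 2)%N by rewrite muln2 -[in LHS](odd_double_half l) odd_l.
  by move: (l./2) => t; ring.
have Ccard : \sum_(b : F | b != 0) (1 : int) = (2 ^ f)%:Z - 1.
  rewrite (sum_primitive_powers cardF pg f_gt1) sumr_const card_ord natz -(pred_exp2K f); lia.
have -> : \sum_(b | b != 0) T b = p%:Z ^+ 2 * (\sum_(b | b != 0) Psi b ^+ 2)
   + 2 * p%:Z * (1 - M) * (\sum_(b | b != 0) Psi b)
   + ((1 - M) ^+ 2 - (p%:Z * M) ^+ 2) * (\sum_(b : F | b != 0) 1).
  rewrite !mulr_sumr -!big_split /=; apply: eq_bigr => b _; rewrite /T; ring.
move: S1 S2 Dcard Dq Ccard.
move: (\sum_(b | b != 0) Psi b) (\sum_(b | b != 0) Psi b ^+ 2) (\sum_(b | b != 0) 1) => s1 s2 s3.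
move: M (2 ^ f)%:Z #|D|%:Z p%:Z => M0 q k P S1 S2 Dk Dq ->.
have -> : s1 = - k by apply/eqP; rewrite -addr_eq0 addrC S1.
have -> : s2 = q * k - k ^+ 2 by rewrite -S2; ring.
(* After substituting P k = q - 1, the factor q - 1 splits off and leaves (P - 1) q + M0^2 (1 -
   P^2), which is 0 because q = (P + 1) M0^2. *)
transitivity (P * q * (P * k) - (P * k) ^+ 2 - 2 * (1 - M0) * (P * k)
    + ((1 - M0) ^+ 2 - (P * M0) ^+ 2) * (q - 1)); first by ring.
by rewrite Dk Dq; ring.
Qed.

Theorem strongly_regular_cyclotomic_union : strongly_regular (Cay D).
Proof.
have nz_p : p%:Z != 0 by rewrite eqz_nat -lt0n prime_gt0.
(* The elements g^0 and g^l witness that the graph is neither edgeless nor complete. *)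
have g0D : g ^+ 0 \in D by rewrite mem_cyclotomic_union mod0n.
have glD : g ^+ l \notin D.
  by rewrite mem_cyclotomic_union modn_small ?ltnn // ltn_exp2l ?prime_gt1.
exact: (strongly_regular_two_eigenvalues cardF (sum_psi cardF pg f_gt1) nz_p
  cay_eigenvalue_quadratic zero_notin_cyclotomic_union g0D
  (expf_neq0 l (primitive_root_neq0 pg f_gt1)) glD).
Qed.

End MersenneCyclotomic.

(** * Specialization to p = 127 and r = 7 *)

Theorem mainTheorem6 (m : nat) (F : finFieldType) (gamma : F) :
  (1 <= m)%N ->
  let N := (127 ^ m)%N in
  let f := (totient N %/ 18)%N in
  let q := (2 ^ f)%N in
  #|F| = q ->
  (q.-1).-primitive_root gamma ->
  let D := (\bigcup_(i < 127 ^ m.-1) cyclotomic_class gamma N i)%SET in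
  [/\ is_mult_order N 2 f, (N %| q.-1)%N & strongly_regular (Cay D)].
Proof.
case: m => // m _ N f q cardF pg D.
have pr : prime 127 by [].
have p2r : 127.+1 = (2 ^ 7)%N by [].
(* Here [m] has been shifted down by one, and 126 = 18 * 7. *)
have fE : f = (7 * 127 ^ m)%N.
  by rewrite /f /N totient_pfactor // -[127.-1]/(18 * 7)%N -mulnA mulKn.
have dvdE e : (2 ^ e == 1 %[mod N])%N = (f %| e)%N.
  by rewrite eqn_mod_dvd ?expn_gt0 // subn1 (dvdn_pred_exp2 pr p2r) fE.
have f_gt0 : (0 < f)%N by rewrite fE muln_gt0 expn_gt0.
split; last first.
- have cardF' : #|F| = (2 ^ (7 * 127 ^ m))%N by rewrite cardF /q fE.
  have pg' : (2 ^ (7 * 127 ^ m)).-1.-primitive_root gamma by rewrite -fE.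
  exact: (strongly_regular_cyclotomic_union pr p2r cardF' pg').
- by rewrite /q (dvdn_pred_exp2 pr p2r) fE.
split=> // [|e e_gt0 /eqP].
  by apply/eqP; rewrite dvdE.
by rewrite dvdE; apply: dvdn_leq.
Qed.
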